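(* Let $r_0$ be a positive real number. For every $n=1,2,\ldots$, $$k_{25^nr_0}=\sqrt{\frac12-\frac12\sqrt{1-4\left(k_{r_0}k'_{r_0}\right)^2\prod_{j=1}^{n}\left(P^{(j)}\!\left(\sqrt[12]{\frac{k_{r_0}k'_{r_0}}{k_{r_0/25}\,k'_{r_0/25}}}\right)\right)^{24}}}\,,$$ where $P(x)=U\!\left(\left[Q\!\left(U^{*}(x)^6\right)\right]^{1/6}\right)$ and $P^{(j)}=P\circ\cdots\circ P$ ($j$ times).
   Context: For $0<x<1$ let $K(x)=\int_0^{\pi/2}\frac{dt}{\sqrt{1-x^2\sin^2 t}}$ be the complete elliptic integral of the first kind. For real $r>0$, the elliptic singular modulus $k_r$ is the unique real number with $0<k_r<1$ and $K\!\left(\sqrt{1-k_r^2}\right)/K(k_r)=\sqrt r$; set $k'_r=\sqrt{1-k_r^2}$. Define the following functions (positive real arguments; all square, cube and sixth roots are principal values; in $h$ the radicand of the square root is negative, so $h$ is complex, while $U$ takes positive real values): $$U(X)=\sqrt{-\frac{5}{3X^2}+\frac{25}{3X^2h(X)}+\frac{X^4}{h(X)}+\frac{h(X)}{3X^2}},\qquad h(x)=\left(-125-9x^6+3\sqrt3\sqrt{-125x^6-22x^{12}-x^{18}}\right)^{1/3}.$$ $U(X)$ is a solution $Y$ of $\frac{X^2}{\sqrt5Y}-\frac{\sqrt5Y}{X^2}=\frac1{\sqrt5}(Y^3-Y^{-3})$. $$U^{*}(Y)=\sqrt{-\frac1{2Y^2}+\frac{Y^4}2+\frac{\sqrt{1+18Y^6+Y^{12}}}{2Y^2}},$$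 which is the solution $X$ of the same equation. $$Q(x)=\frac{\left(-1-e^{\frac15y}+e^{\frac25y}\right)^5}{e^{\frac15y}-e^{\frac25y}+2e^{\frac35y}-3e^{\frac45y}+5e^{y}+3e^{\frac65y}+2e^{\frac75y}+e^{\frac85y}+e^{\frac95y}},\qquad y=\operatorname{arcsinh}\!\left(\frac{11+x}{2}\right).$$
   Formalization: The formula is proved only when 25^n r_0 ≥ 1; for 25^n r_0 < 1 the printed formula is false, since its right-hand side is at most 1/√2 while k_r > 1/√2 for every r < 1. *)

(* Defs.v *)
From Stdlib Require Import Reals Lra Lia List.
From Coquelicot Require Export Coquelicot.
Open Scope R_scope.

Definition ellK (x : R) : R :=
  RInt (fun t => 1 / sqrt (1 - x ^ 2 * sin t ^ 2)) 0 (PI / 2).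

Definition is_singular_modulus (r k : R) : Prop :=
  0 < k < 1 /\ ellK (sqrt (1 - k ^ 2)) / ellK k = sqrt r.

(** [iota] is a definite-description operator: it returns the element
    satisfying the predicate when exactly one exists ([iota_correct]). *)
Definition sing_mod (r : R) : R :=
  iota (T := R_CompleteNormedModule) (is_singular_modulus r).

Definition sing_mod' (r : R) : R := sqrt (1 - sing_mod r ^ 2).

(** Meaningful for [0 < x] only: [Rpower] takes a junk value elsewhere. *)
Definition Rroot (n : nat) (x : R) : R := Rpower x (/ INR n).

(** Principal argument, in (-PI, PI] for [z <> 0]. *)
Definition Carg (z : C) : R :=
  if Rle_dec 0 (Im z) then acos (Re z / Cmod z) else - acos (Re z / Cmod z).

(** Principal [n]-th root |z|^(1/n) exp(i arg(z)/n). *)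
Definition Croot (n : nat) (z : C) : C :=
  if Ceq_dec z (RtoC 0) then RtoC 0
  else (RtoC (Rroot n (Cmod z)) * (cos (Carg z / INR n), sin (Carg z / INR n)))%C.

Definition h (x : R) : C :=
  Croot 3 (RtoC (-125 - 9 * x ^ 6)
           + RtoC (3 * sqrt 3)
             * Croot 2 (RtoC (-125 * x ^ 6 - 22 * x ^ 12 - x ^ 18)))%C.

Definition U_complex (X : R) : C :=
  Croot 2 (RtoC (- (5 / (3 * X ^ 2)))
           + RtoC 25 / (RtoC (3 * X ^ 2) * h X)
           + RtoC (X ^ 4) / h X
           + h X / RtoC (3 * X ^ 2))%C.

(** For [0 < X] nothing is lost in taking the real part: see [U_complexE]. *)
Definition U (X : R) : R := Re (U_complex X).

Definition Ustar (Y : R) : R :=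
  sqrt (- (1 / (2 * Y ^ 2)) + Y ^ 4 / 2
        + sqrt (1 + 18 * Y ^ 6 + Y ^ 12) / (2 * Y ^ 2)).

Definition Q (x : R) : R :=
  let y := arcsinh ((11 + x) / 2) in
  (-1 - exp (1 / 5 * y) + exp (2 / 5 * y)) ^ 5 /
  (exp (1 / 5 * y) - exp (2 / 5 * y) + 2 * exp (3 / 5 * y)
   - 3 * exp (4 / 5 * y) + 5 * exp y + 3 * exp (6 / 5 * y)
   + 2 * exp (7 / 5 * y) + exp (8 / 5 * y) + exp (9 / 5 * y)).

Definition P (x : R) : R := U (Rroot 6 (Q (Ustar x ^ 6))).

(** f 1 * ... * f n *)
Definition prod_1_to (n : nat) (f : nat -> R) : R :=
  fold_right Rmult 1 (map f (seq 1 n)).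

Lemma Rroot_pow (n : nat) (x : R) : (0 < n)%nat -> 0 < x -> Rroot n x ^ n = x.
Proof.
intros hn hx; unfold Rroot.
rewrite <- Rpower_pow by apply exp_pos.
rewrite Rpower_mult, Rinv_l by (apply not_0_INR; lia).
now apply Rpower_1.
Qed.

Lemma Croot_pos (n : nat) (x : R) : 0 < x -> Croot n (RtoC x) = RtoC (Rroot n x).
Proof.
intros hx; unfold Croot.
destruct (Ceq_dec (RtoC x) (RtoC 0)) as [e|_]; [apply RtoC_inj in e; lra|].
assert (ha : Carg (RtoC x) = 0).
{ unfold Carg; rewrite Cmod_R, Rabs_pos_eq by lra; simpl.
  destruct (Rle_dec 0 0) as [_|]; [|lra].
  replace (x / x) with 1 by (field; lra); apply acos_1. }
rewrite ha, Cmod_R, Rabs_pos_eq by lra.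
unfold Rdiv; rewrite Rmult_0_l, cos_0, sin_0.
apply injective_projections; simpl; ring.
Qed.

Lemma Re_Croot3_ge (z : C) : z <> RtoC 0 -> Rroot 3 (Cmod z) / 2 <= Re (Croot 3 z).
Proof.
intros hz; unfold Croot; destruct (Ceq_dec z (RtoC 0)) as [e|_]; [easy|].
set (c := cos _); set (s := sin _); simpl.
assert (hc : / 2 <= c).
{ assert (H : / 2 <= cos (acos (Re z / Cmod z) / 3)).
  { rewrite <- Rdiv_1_l, <- cos_PI3.
    assert (B := acos_bound (Re z / Cmod z)); assert (Pp := PI_RGT_0).
    apply cos_decr_1; lra. }
  unfold c, Carg; replace (INR 3) with 3 by (simpl; lra).
  destruct (Rle_dec 0 (Im z)); [easy|].
  rewrite Rdiv_opp_l, cos_neg; exact H. }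
assert (hp : 0 < Rroot 3 (Cmod z)) by apply exp_pos.
nra.
Qed.

Lemma Cmod_Croot (n : nat) (z : C) : z <> RtoC 0 -> Cmod (Croot n z) = Rroot n (Cmod z).
Proof.
intros hz; unfold Croot; destruct (Ceq_dec z (RtoC 0)) as [e|_]; [easy|].
set (a := Carg z / INR n).
rewrite Cmod_mult, Cmod_R, Rabs_pos_eq by (left; apply exp_pos).
unfold Cmod; simpl fst; simpl snd.
replace (cos a ^ 2 + sin a ^ 2) with 1
  by (generalize (sin2_cos2 a); unfold Rsqr; nra).
rewrite sqrt_1; ring.
Qed.

Lemma Croot2_neg (x : R) : 0 < x -> Croot 2 (RtoC (- x)) = (0, sqrt x).
Proof.
intros hx; unfold Croot.
destruct (Ceq_dec (RtoC (- x)) (RtoC 0)) as [e|_]; [apply RtoC_inj in e; lra|].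
assert (ha : Carg (RtoC (- x)) = PI).
{ unfold Carg; rewrite Cmod_R, Rabs_Ropp, Rabs_pos_eq by lra; simpl.
  destruct (Rle_dec 0 0) as [_|]; [|lra].
  replace (- x / x) with (- (1)) by (field; lra).
  rewrite acos_opp, acos_1; ring. }
rewrite ha, Cmod_R, Rabs_Ropp, Rabs_pos_eq by lra.
replace (INR 2) with 2 by (simpl; lra).
rewrite cos_PI2, sin_PI2.
replace (Rroot 2 x) with (sqrt x)
  by (unfold Rroot; rewrite <- Rpower_sqrt by easy; f_equal; simpl; lra).
apply injective_projections; simpl; ring.
Qed.

Lemma h_facts (x : R) : 0 < x ->
  Re (h x) ^ 2 + Im (h x) ^ 2 = 25 + 3 * x ^ 6 /\ 5 < 2 * Re (h x).
Proof.
intros hx.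
assert (h6 : 0 < x ^ 6) by (apply pow_lt; easy).
set (a := x ^ 6) in *.
assert (hs : 0 < 125 * a + 22 * a ^ 2 + a ^ 3) by nra.
assert (s3 : sqrt 3 ^ 2 = 3) by (apply pow2_sqrt; lra).
assert (ss : sqrt (125 * a + 22 * a ^ 2 + a ^ 3) ^ 2 = 125 * a + 22 * a ^ 2 + a ^ 3)
  by (apply pow2_sqrt; lra).
unfold h; fold a.
replace (-125 * a - 22 * x ^ 12 - x ^ 18)
  with (- (125 * a + 22 * a ^ 2 + a ^ 3)) by (unfold a; ring).
rewrite Croot2_neg by easy.
set (s := sqrt (125 * a + _ + _)) in *.
set (w := Cplus _ _).
assert (hw : w = (-125 - 9 * a, 3 * sqrt 3 * s))
  by (apply injective_projections; simpl; ring).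
assert (hw0 : w <> RtoC 0).
{ rewrite hw; intros e; apply (f_equal fst) in e; simpl in e; lra. }
assert (hm : Cmod w ^ 2 = (25 + 3 * a) ^ 3).
{ rewrite hw; unfold Cmod; rewrite pow2_sqrt by (simpl; nra); simpl fst; simpl snd.
  replace ((3 * sqrt 3 * s) ^ 2) with (9 * (sqrt 3 ^ 2) * (s ^ 2)) by ring.
  rewrite s3, ss; ring. }
assert (hpos : 0 < Cmod w) by (apply Cmod_gt_0; exact hw0).
assert (hr := Rroot_pow 3 _ ltac:(lia) hpos).
assert (hre := Re_Croot3_ge w hw0).
assert (hmod := Cmod_Croot 3 w hw0).
assert (hrp : 0 < Rroot 3 (Cmod w)) by apply exp_pos.
set (rho := Rroot 3 (Cmod w)) in *.
assert (hrho : rho ^ 2 = 25 + 3 * a).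
{ assert (e : (rho ^ 2) ^ 3 = (25 + 3 * a) ^ 3)
    by (rewrite <- hm, <- hr; ring).
  assert (0 < rho ^ 2) by (apply pow_lt; easy).
  set (p := rho ^ 2) in *; set (q := 25 + 3 * a) in *.
  assert (0 < q) by (unfold q; lra).
  assert ((p - q) * (p ^ 2 + p * q + q ^ 2) = 0)
    by (transitivity (p ^ 3 - q ^ 3); [ring|lra]).
  assert (0 < p ^ 2 + p * q + q ^ 2) by nra.
  nra. }
split.
- rewrite <- hrho, <- hmod; unfold Cmod.
  rewrite pow2_sqrt; [reflexivity|].
  apply Rplus_le_le_0_compat; apply pow2_ge_0.
- assert (5 < rho) by nra; lra.
Qed.

Lemma U_complexE (X : R) : 0 < X -> U_complex X = RtoC (U X) /\ 0 < U X.
Proof.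
intros hX; unfold U, U_complex.
destruct (h_facts X hX) as [hm hre].
destruct (h X) as [p q]; simpl Re in *; simpl Im in *.
assert (hX2 : 0 < X ^ 2) by (apply pow_lt; easy).
assert (hX6 : 0 < X ^ 6) by (apply pow_lt; easy).
set (z := Cplus _ _).
assert (hz : z = RtoC ((2 * p - 5) / (3 * X ^ 2))).
{ unfold z.
  assert (hpq : (p, q) <> RtoC 0)
    by (intros e; apply (f_equal fst) in e; simpl in e; lra).
  assert (hX0 : RtoC (3 * X ^ 2) <> RtoC 0)
    by (intros e; apply RtoC_inj in e; lra).
  assert (hi : (/ (p, q))%C = (p / (25 + 3 * X ^ 6), - q / (25 + 3 * X ^ 6)))
    by (unfold Cinv; simpl fst; simpl snd; rewrite hm; reflexivity).
  assert (e1 : forall (c : R) (w : C), RtoC c <> RtoC 0 -> w <> RtoC 0 ->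
    (RtoC 25 / (RtoC c * w) = RtoC (25 / c) * / w)%C)
    by (intros c w hc hw; rewrite RtoC_div by (intros ->; now apply hc); field; split; assumption).
  assert (e2 : forall (c : R) (w : C), RtoC c <> RtoC 0 ->
    (w / RtoC c = RtoC (/ c) * w)%C)
    by (intros c w hc; rewrite RtoC_inv by (intros ->; now apply hc); field; assumption).
  rewrite e1, e2 by assumption.
  unfold Cdiv; rewrite hi.
  apply injective_projections; simpl; field; lra. }
rewrite hz, Croot_pos by (apply Rdiv_lt_0_compat; lra).
split; [reflexivity|apply exp_pos].
Qed.

(* Main.v *)
(** Write l, k for the moduli at r and 25r, and N = K(l)/K(k) for the quotient of the
    complete integrals, which lies in (1, 5). The squared moduli are explicit functions
    [lam2 N], [kap2 N]: Jacobi's transformation of degree 5, an explicit substitution of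
    the amplitude, gives K(l) = N K(k), and since N -> 5/N exchanges the pair with the
    pair of complementary moduli, it also multiplies K'/K by 5.

    Let Y be the 12th root of the quotient of the products k k' at 25r and r. Then
    Y^6 = N (N - 1) / (5 - N), and t = U*(Y)^6 = 125 (N - 1)^2 / (N (5 - N)^2). With
    T(x) = x (x^4 + 5 x^3 + 15 x^2 + 25 x + 25), the map Q sends t = T(x) to
    s = 125 / T(5/x), and U(s^(1/6))^6 = M (M - 1) / (5 - M) where
    s = 125 (M - 1)^2 / (M (5 - M)^2). The pair belonging to M starts where the pair
    belonging to N ends, [lam2 M = kap2 N]: the two values of k k' agree because both are
    determined by the modular invariant j, a rational function of t as well as of s, and
    k is distinguished from k' by the position of x relative to sqrt 5. *)

Require Import Defs.
From Stdlib Require Import Reals Ranalysis5 Lra Lia List.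
From Coquelicot Require Import Coquelicot.
Open Scope R_scope.

(** * The complete elliptic integral as a function of the squared modulus *)

Lemma sin2_le1 (t : R) : 0 <= sin t ^ 2 <= 1.
Proof.
assert (H := sin2_cos2 t); rewrite !Rsqr_pow2 in H.
assert (H1 := pow2_ge_0 (sin t)); assert (H2 := pow2_ge_0 (cos t)); lra. Qed.

Lemma ellK_radicand_pos (m t : R) : m < 1 -> 0 < 1 - m * sin t ^ 2.
Proof.
intros hm; destruct (sin2_le1 t) as [[h0|<-] h1]; [|lra].
assert (0 < (1 - m) * sin t ^ 2) by (apply Rmult_lt_0_compat; lra); lra.
Qed.

Lemma ellK_integrand_continuous (m t : R) :
  m < 1 -> continuous (fun t => 1 / sqrt (1 - m * sin t ^ 2)) t.
Proof.
intros hm; assert (H := ellK_radicand_pos m t hm).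
apply (ex_derive_continuous (V := R_NormedModule)).
assert (0 < sqrt (1 - m * sin t ^ 2)) by (now apply sqrt_lt_R0).
auto_derive; replace (1 + _) with (1 - m * sin t ^ 2) by ring; repeat split; lra.
Qed.

Definition ellK_param (m : R) : R :=
  RInt (fun t => 1 / sqrt (1 - m * sin t ^ 2)) 0 (PI / 2).

Lemma ellK_param_ex (m : R) :
  m < 1 -> ex_RInt (fun t => 1 / sqrt (1 - m * sin t ^ 2)) 0 (PI / 2).
Proof.
intros hm; apply (ex_RInt_continuous (V := R_CompleteNormedModule)).
intros t _; now apply ellK_integrand_continuous.
Qed.

(** * Jacobi's transformation of degree 5 *)

(** The half-angle formula tan (psi / 2) = S / (1 + C) lifts a curve on the unit circle with angular
    velocity [w] to an explicit angle, smooth where C is not -1. It yields the new amplitude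
    together with its derivative. *)
Lemma angle_of_curve (S C w : R -> R) (t : R) :
  (forall x, S x ^ 2 + C x ^ 2 = 1) -> 0 < 1 + C t ->
  (forall x, is_derive S x (C x * w x)) -> (forall x, is_derive C x (- (S x * w x))) ->
  let psi := fun x => 2 * atan (S x / (1 + C x)) in
  sin (psi t) = S t /\ is_derive psi t (w t).
Proof.
intros h1 hC hS' hC' psi.
assert (h1t := h1 t); rename hC into hCt.
set (a := S t) in *; set (b := C t) in *.
split.
- unfold psi; fold a b; rewrite sin_2a, sin_atan, cos_atan.
  set (r := a / (1 + b)).
  assert (hr : 0 < 1 + r²) by (unfold Rsqr; nra).
  assert (hs := sqrt_sqrt (1 + r²) (Rlt_le _ _ hr)).
  assert (hs0 := sqrt_lt_R0 _ hr).
  replace (2 * (r / sqrt (1 + r²)) * (1 / sqrt (1 + r²))) with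
    (2 * r / (sqrt (1 + r²) * sqrt (1 + r²))) by (field; lra).
  rewrite hs; unfold Rsqr in *; unfold r.
  assert (e : 1 + a / (1 + b) * (a / (1 + b)) = 2 / (1 + b)).
  { replace (a / (1 + b) * (a / (1 + b))) with (a ^ 2 / (1 + b) ^ 2) by (field; lra).
    replace (a ^ 2) with ((1 - b) * (1 + b)) by lra; field; lra. }
  rewrite e; field; lra.
- assert (d : is_derive (fun x => S x / (1 + C x)) t
    ((a * 0 + (b * w t) * (1 + b) + a * (a * w t)) / (1 + b) ^ 2)).
  { assert (dS := hS' t); assert (dC := hC' t); fold a b in dS, dC.
    assert (dC1 := is_derive_plus _ _ t _ _ (is_derive_const 1 t) dC).
    assert (dq := is_derive_div _ _ t _ _ dS dC1 ltac:(apply Rgt_not_eq; exact hCt)).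
    unfold plus, zero in dq; simpl in dq; fold a b in dq.
    replace (_ / (1 + b) ^ 2)
      with ((b * w t * (1 + b) - a * (0 + - (a * w t))) / ((1 + b) * ((1 + b) * 1)));
      [exact dq|field; lra]. }
  assert (d2 := is_derive_comp atan _ t _ _ (is_derive_atan _) d).
  assert (d3 := is_derive_scal _ t 2 _ d2).
  unfold psi; cbv beta in d3.
  replace (w t) with (2 * (scal ((a * 0 + b * w t * (1 + b) + a * (a * w t)) / (1 + b) ^ 2)
     (/ (1 + (S t / (1 + C t))²)))); [exact d3|].
  fold a b; unfold scal; simpl; unfold mult; simpl.
  replace (1 + (a / (1 + b))²) with (2 / (1 + b)).
  { replace (a * 0 + b * w t * (1 + b) + a * (a * w t)) with ((1 + b) * w t)
      by (transitivity ((b + (a ^ 2 + b ^ 2)) * w t); [rewrite h1t|]; ring).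
    field; lra. }
  unfold Rsqr.
  replace (a / (1 + b) * (a / (1 + b))) with (a ^ 2 / (1 + b) ^ 2) by (field; lra).
  replace (a ^ 2) with ((1 - b) * (1 + b)) by lra; field; lra.
Qed.

(* [g = (N - 1) / 2]; [A] and [D] are the odd and even parts of
   (1 + x) (1 + g x + h x^2)^2 with [s = x^2], and sin psi = x A / D for x = sin t.
   The relation between [g] and [h] makes x -> 1 / (sqrt kap * x) exchange the zeros and
   the poles of x A / D. *)
Section JacobiTransformation.
Variables g h : R.
Hypotheses (hg : 0 < g < 2) (hh : 0 < h) (rel : g ^ 3 = 2 * h * (1 + g + h)).

Let kap := h * (h + g ^ 2) / (1 + 2 * g).
Let lam := (h + g ^ 2) * (h + 2 * g) ^ 2 / (h * (1 + 2 * g) ^ 3).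

Lemma jacobi_h_lt1 : h < 1.
Proof. nra. Qed.

(** If g >= 1 + h, then [rel] gives g^2 <= 4 h, against g^2 >= (1 + h)^2 > 4 h. *)
Lemma jacobi_g_lt : g < 1 + h.
Proof.
assert (H := jacobi_h_lt1).
destruct (Rlt_le_dec g (1 + h)) as [|hge]; [easy|].
assert (g ^ 3 <= 4 * h * g) by nra.
assert (g ^ 2 <= 4 * h) by nra.
nra.
Qed.

Let A s := (1 + 2 * g) + (g ^ 2 + 2 * h + 2 * g * h) * s + h ^ 2 * s ^ 2.
Let D s := 1 + (g ^ 2 + 2 * g + 2 * h) * s + (h ^ 2 + 2 * g * h) * s ^ 2.
(** The identity D^2 - s A^2 = (1 - s) F^2 makes cos t * F / D the cosine of psi; the derivative of
    psi is H / D. *)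
Let F s := (1 + h * s) ^ 2 - g ^ 2 * s.
Let H s := (1 + 2 * g) - (g ^ 2 + 2 * g - 2 * h + 2 * g * h) * s + h * (h + 2 * g) * s ^ 2.

Lemma jacobi_D_pos s : 0 <= s -> 0 < D s.
Proof.
intros hs; unfold D.
assert (0 < g * g) by nra. assert (0 < g * h) by nra.
assert (0 <= s ^ 2) by nra. nra.
Qed.

Lemma jacobi_F_pos s : 0 <= s <= 1 -> 0 < F s.
Proof.
intros hs; assert (H1 := jacobi_h_lt1); assert (H2 := jacobi_g_lt).
replace (F s) with (s * ((1 + h) ^ 2 - g ^ 2) + (1 - s) * (1 - h ^ 2 * s))
  by (unfold F; ring).
assert (0 < (1 + h) ^ 2 - g ^ 2) by nra.
assert (h ^ 2 < 1) by nra.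
assert (0 < 1 - h ^ 2 * s) by nra.
destruct (Req_dec s 1); [subst; lra|].
assert (0 < (1 - s) * (1 - h ^ 2 * s)) by (apply Rmult_lt_0_compat; lra).
nra.
Qed.

Lemma jacobi_H_pos s : 0 <= s <= 1 -> 0 < H s.
Proof.
intros hs; assert (H1 := jacobi_h_lt1); assert (H2 := jacobi_g_lt).
replace (H s) with ((1 - s) * (1 + 2 * g - h * (h + 2 * g) * s) + s * ((1 + h) ^ 2 - g ^ 2))
  by (unfold H; ring).
assert (0 < (1 + h) ^ 2 - g ^ 2) by nra.
assert (0 < h * (h + 2 * g) < 1 + 2 * g) by nra.
assert (0 < 1 + 2 * g - h * (h + 2 * g) * s) by nra.
destruct (Req_dec s 1); [subst; lra|].
assert (0 < (1 - s) * (1 + 2 * g - h * (h + 2 * g) * s))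
  by (apply Rmult_lt_0_compat; lra).
nra.
Qed.

Lemma jacobi_kap_bounds : 0 < kap < 1.
Proof.
assert (H1 := jacobi_h_lt1). assert (0 < g * g) by nra.
unfold kap; split.
- apply Rdiv_lt_0_compat; nra.
- apply Rlt_div_l; [lra|].
  assert (h * g < 2) by nra. assert (h * h < 1) by nra. nra.
Qed.

(** The relation between [g] and [h] makes 1 - lam sin^2 psi equal to 1 - kap sin^2 t times a
    square, whose root cancels psi' = H / D up to the factor 1 + 2 g. *)
Lemma jacobi_lam_identity s :
  (1 + 2 * g) ^ 2 * (D s ^ 2 - lam * s * A s ^ 2) = (1 - kap * s) * H s ^ 2.
Proof.
unfold lam, kap.
apply (Rmult_eq_reg_l (h * (1 + 2 * g))); [|nra].
transitivity (h * (1 + 2 * g) ^ 3 * D s ^ 2 - (h + g ^ 2) * (h + 2 * g) ^ 2 * s * A s ^ 2);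
  [field; lra|].
transitivity (h * ((1 + 2 * g) - h * (h + g ^ 2) * s) * H s ^ 2); [|field; lra].
apply Rminus_diag_uniq.
(* The cofactor is the quotient of the difference of the two sides by the polynomial that [rel]
   makes vanish. *)
transitivity ((g ^ 3 - 2 * h * (1 + g + h)) *
  (-4 * g ^ 5 * s ^ 3 - 20 * g ^ 4 * h * s ^ 3 + 8 * g ^ 4 * h * s ^ 2 - 16 * g ^ 4 * s
    ^ 2 - 8 * g ^ 3 * h ^ 2 * s ^ 4 - 28 * g ^ 3 * h * s ^ 3 - 4 * g ^ 3 * h * s ^ 2 - 8
    * g ^ 3 * s ^ 2 - 16 * g ^ 3 * s + 4 * g ^ 2 * h ^ 3 * s ^ 4 - 16 * g ^ 2 * h ^ 2 *
    s ^ 3 + 8 * g ^ 2 * h ^ 2 * s ^ 2 - 8 * g ^ 2 * h * s ^ 3 - 20 * g ^ 2 * h * s ^ 2 -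
    16 * g ^ 2 * s + 4 * g * h ^ 4 * s ^ 4 + 8 * g * h ^ 3 * s ^ 3 - 4 * g * h ^ 2 * s ^
    3 + 4 * g * h ^ 2 * s ^ 2 - 8 * g * h * s ^ 2 - 4 * g * s)).
- unfold A, D, H; ring.
- rewrite rel; ring.
Qed.

(** At s = 1 the forms [A] and [D] coincide, and the identity writes 1 - lam as 1 - kap times a
    square. *)
Lemma jacobi_lam_lt1 : lam < 1.
Proof.
assert (e := jacobi_lam_identity 1).
assert (hD : A 1 = D 1) by (unfold A, D; ring).
rewrite hD in e.
assert (h1 := jacobi_D_pos 1 ltac:(lra)); assert (h2 := jacobi_H_pos 1 ltac:(lra)).
assert (h3 := jacobi_kap_bounds).
assert (0 < (1 - kap * 1) * H 1 ^ 2) by (apply Rmult_lt_0_compat; [lra|now apply pow_lt]).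
assert (0 < ((1 + 2 * g) * D 1) ^ 2) by (apply pow_lt; nra).
nra.
Qed.

Theorem jacobi_transformation : ellK_param lam = (1 + 2 * g) * ellK_param kap.
Proof.
set (sq := fun t => sin t ^ 2).
set (S := fun t => sin t * A (sq t) / D (sq t)).
set (C := fun t => cos t * F (sq t) / D (sq t)).
set (w := fun t => H (sq t) / D (sq t)).
assert (hsq : forall t, 0 <= sq t <= 1) by (intros t; apply sin2_le1).
assert (hc : forall t, cos t ^ 2 = 1 - sq t).
{ intros t; unfold sq; assert (e := sin2_cos2 t); unfold Rsqr in e; lra. }
assert (hD : forall t, 0 < D (sq t)) by (intros t; apply jacobi_D_pos, hsq).
assert (hSC : forall t, S t ^ 2 + C t ^ 2 = 1).
{ intros t; unfold S, C.
  transitivity ((sin t ^ 2 * A (sq t) ^ 2 + cos t ^ 2 * F (sq t) ^ 2) / D (sq t) ^ 2).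
  - field; specialize (hD t); lra.
  - rewrite hc; fold (sq t).
    replace (sq t * A (sq t) ^ 2 + (1 - sq t) * F (sq t) ^ 2) with (D (sq t) ^ 2)
      by (unfold A, F, D; ring).
    field; specialize (hD t); lra. }
assert (hC0 : forall t, 0 <= t <= PI / 2 -> 0 <= C t).
{ intros t ht; unfold C.
  assert (0 <= cos t) by (apply cos_ge_0; lra).
  assert (0 < F (sq t)) by (apply jacobi_F_pos, hsq).
  apply Rmult_le_pos; [nra|apply Rlt_le, Rinv_0_lt_compat, hD]. }
assert (dS : forall t, is_derive S t (C t * w t)).
{ intros t; assert (hDt := hD t); unfold S, C, w.
  unfold A, D, sq; unfold D, sq in hDt.
  auto_derive; [lra|].
  apply Rminus_diag_uniq; unfold F, H; set (c := cos t); set (x := sin t) in *.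
  field; lra. }
assert (dC : forall t, is_derive C t (- (S t * w t))).
{ intros t; assert (hDt := hD t); assert (hct := hc t); unfold S, C, w.
  unfold F, D, sq; unfold D, sq in hDt; unfold sq in hct.
  auto_derive; [lra|].
  set (c := cos t) in *; set (x := sin t) in *.
  (* Isolating cos^2 lets it be replaced by 1 - sin^2; what remains is a rational identity in
     [x]. *)
  transitivity (- x * F (x ^ 2) / D (x ^ 2) + c ^ 2 * (2 * x *
    ((2 * h * (1 + h * x ^ 2) - g ^ 2) * D (x ^ 2) - F (x ^ 2) *
     (g ^ 2 + 2 * g + 2 * h + 2 * (h ^ 2 + 2 * g * h) * x ^ 2)) / D (x ^ 2) ^ 2)).
  - unfold F, D; field; lra.
  - rewrite hct; unfold F, D, A, H; field; lra. }
set (psi := fun t => 2 * atan (S t / (1 + C t))).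
assert (hpsi : forall t, 0 <= t <= PI / 2 -> sin (psi t) = S t /\ is_derive psi t (w t)).
{ intros t ht; apply angle_of_curve; trivial; specialize (hC0 t ht); lra. }
assert (psi0 : psi 0 = 0).
{ unfold psi, S; rewrite sin_0; unfold Rdiv; rewrite !Rmult_0_l, atan_0; ring. }
assert (psi1 : psi (PI / 2) = PI / 2).
{ unfold psi, S, C, sq; rewrite cos_PI2, sin_PI2.
  replace (_ / (1 + _)) with 1.
  - rewrite atan_1; field.
  - assert (e := hD (PI / 2)); unfold sq in e; rewrite sin_PI2 in e.
    unfold A; unfold D in *; field; lra. }
assert (hlam := jacobi_lam_lt1); assert (hkap := jacobi_kap_bounds).
assert (cv := RInt_comp (V := R_CompleteNormedModule)
  (fun t => 1 / sqrt (1 - lam * sin t ^ 2)) psi w 0 (PI / 2)).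
rewrite psi0, psi1 in cv.
assert (Pp := PI_RGT_0).
unfold ellK_param; rewrite <- cv; clear cv.
- transitivity (RInt (V := R_CompleteNormedModule)
    (fun t => scal (1 + 2 * g) (1 / sqrt (1 - kap * sin t ^ 2))) 0 (PI / 2)).
  + apply RInt_ext; intros t; rewrite Rmin_left, Rmax_right by lra; intros ht.
    change (w t * (1 / sqrt (1 - lam * sin (psi t) ^ 2)) =
      (1 + 2 * g) * (1 / sqrt (1 - kap * sin t ^ 2))).
    destruct (hpsi t ltac:(lra)) as [-> _].
    assert (hDt := hD t); assert (hH := jacobi_H_pos _ (hsq t)).
    assert (hk := ellK_radicand_pos kap t (proj2 hkap)).
    assert (e := jacobi_lam_identity (sq t)).
    assert (es : 1 - lam * S t ^ 2 =
      (1 - kap * sq t) * (H (sq t) / ((1 + 2 * g) * D (sq t))) ^ 2).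
    { transitivity (((1 + 2 * g) ^ 2 * (D (sq t) ^ 2 - lam * sq t * A (sq t) ^ 2)) /
        ((1 + 2 * g) * D (sq t)) ^ 2).
      - unfold S; transitivity (((1 + 2 * g) ^ 2 * (D (sq t) ^ 2 - lam * sin t ^ 2 * A (sq t) ^ 2)) /
          ((1 + 2 * g) * D (sq t)) ^ 2); [field; split; lra|reflexivity].
      - rewrite e; field; split; lra. }
    rewrite es, sqrt_mult_alt, sqrt_pow2 by (try apply Rlt_le, Rdiv_lt_0_compat; fold (sq t) in hk; nra).
    fold (sq t) in hk |- *; unfold w.
    assert (0 < sqrt (1 - kap * sq t)) by (now apply sqrt_lt_R0).
    field; repeat split; lra.
  + rewrite (RInt_scal (V := R_CompleteNormedModule)); [reflexivity|].
    now apply ellK_param_ex.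
- intros t _; now apply ellK_integrand_continuous.
- intros t; rewrite Rmin_left, Rmax_right by lra; intros ht; split; [now apply hpsi|].
  apply (ex_derive_continuous (V := R_NormedModule)).
  assert (hDt := hD t); unfold w, H, D, sq in *; auto_derive; lra.
Qed.
End JacobiTransformation.

(** * The moduli at r and 25r in terms of N *)

Definition mrho (N : R) : R := sqrt (N ^ 3 - 2 * N ^ 2 + 5 * N).
(* [lam2 N] and [kap2 N] are the squared moduli at r and 25r. *)
Definition kap2 (N : R) : R := 1 / 2 - (1 + 4 * N - N ^ 2) * mrho N / (16 * N).
Definition lam2 (N : R) : R := 1 / 2 + (N ^ 2 + 20 * N - 25) * mrho N / (16 * N ^ 3).

Lemma mrho_radicand_pos (N : R) : 0 < N -> 0 < N ^ 3 - 2 * N ^ 2 + 5 * N.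
Proof.
intros hN; replace (N ^ 3 - 2 * N ^ 2 + 5 * N) with (N * ((N - 1) ^ 2 + 4)) by ring.
apply Rmult_lt_0_compat; [easy|]; generalize (pow2_ge_0 (N - 1)); lra.
Qed.

Lemma mrho_sqr (N : R) : 0 < N -> mrho N ^ 2 = N ^ 3 - 2 * N ^ 2 + 5 * N.
Proof. intros hN; apply pow2_sqrt, Rlt_le, mrho_radicand_pos, hN. Qed.

Lemma mrho_pos (N : R) : 0 < N -> 0 < mrho N.
Proof. intros hN; now apply sqrt_lt_R0, mrho_radicand_pos. Qed.

Lemma mrho_dual (N : R) : 0 < N -> mrho (5 / N) = 5 * mrho N / N ^ 2.
Proof.
intros hN; assert (h1 := mrho_pos N hN); assert (h2 := mrho_sqr N hN).
unfold mrho at 1; apply sqrt_lem_1.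
- apply Rlt_le, mrho_radicand_pos; now apply Rdiv_lt_0_compat; [lra|].
- apply Rlt_le, Rdiv_lt_0_compat; [lra|now apply pow_lt].
- transitivity (25 * mrho N ^ 2 / N ^ 4); [field; lra|].
  rewrite h2; field; lra.
Qed.

Lemma kap2_dual (N : R) : 0 < N -> kap2 (5 / N) = 1 - lam2 N.
Proof. intros hN; unfold kap2, lam2; rewrite mrho_dual by easy; field; lra. Qed.

Lemma lam2_dual (N : R) : 0 < N -> lam2 (5 / N) = 1 - kap2 N.
Proof. intros hN; unfold kap2, lam2; rewrite mrho_dual by easy; field; lra. Qed.

Lemma kap2_compl (N : R) :
  0 < N -> kap2 N * (1 - kap2 N) = (N - 1) ^ 5 * (5 - N) / (256 * N).
Proof.
intros hN; unfold kap2.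
transitivity (1 / 4 - (1 + 4 * N - N ^ 2) ^ 2 * mrho N ^ 2 / (256 * N ^ 2)); [field; lra|].
rewrite mrho_sqr by easy; field; lra.
Qed.

Lemma lam2_compl (N : R) :
  0 < N -> lam2 N * (1 - lam2 N) = (N - 1) * (5 - N) ^ 5 / (256 * N ^ 5).
Proof.
intros hN; unfold lam2.
transitivity (1 / 4 - (N ^ 2 + 20 * N - 25) ^ 2 * mrho N ^ 2 / (256 * N ^ 6)); [field; lra|].
rewrite mrho_sqr by easy; field; lra.
Qed.

(** A product x (1 - x) is positive only for x between 0 and 1. *)
Lemma kap2_bounds (N : R) : 1 < N < 5 -> 0 < kap2 N < 1.
Proof.
intros hN; assert (e := kap2_compl N ltac:(lra)).
assert (0 < (N - 1) ^ 5) by (apply pow_lt; lra).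
assert (0 < (N - 1) ^ 5 * (5 - N) / (256 * N)) by (apply Rdiv_lt_0_compat; nra).
nra.
Qed.

Lemma dual_range (N : R) : 1 < N < 5 -> 1 < 5 / N < 5.
Proof.
intros hN; split; [apply Rlt_div_r|apply Rlt_div_l]; lra.
Qed.

Lemma lam2_bounds (N : R) : 1 < N < 5 -> 0 < lam2 N < 1.
Proof.
intros hN; assert (e := kap2_dual N ltac:(lra)).
assert (H := kap2_bounds _ (dual_range N hN)); lra.
Qed.

Lemma ellK_param_quintic (N : R) :
  1 < N < 5 -> ellK_param (lam2 N) = N * ellK_param (kap2 N).
Proof.
intros hN; assert (h1 := mrho_pos N ltac:(lra)); assert (h2 := mrho_sqr N ltac:(lra)).
(* For this g, [rel] is a quadratic in h; [h] is its positive root, [mrho] being the square root of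
   (N + 1)^2 + (N - 1)^3. *)
set (g := (N - 1) / 2); set (h := (mrho N - N - 1) / 4).
assert (eN : N = 1 + 2 * g) by (unfold g; field).
assert (er : mrho N = 4 * h + 2 + 2 * g) by (unfold g, h; field).
assert (hh : 0 < h).
{ assert (0 < (N - 1) ^ 3) by (apply pow_lt; lra).
  assert (mrho N ^ 2 - (N + 1) ^ 2 = (N - 1) ^ 3) by (rewrite h2; ring).
  unfold h; nra. }
assert (rel : g ^ 3 = 2 * h * (1 + g + h)).
{ rewrite er, eN in h2; lra. }
assert (hg : 0 < g < 2) by lra.
assert (J := jacobi_transformation g h hg hh rel).
assert (ek : kap2 N = h * (h + g ^ 2) / (1 + 2 * g)).
{ unfold kap2; rewrite er, eN.
  apply Rminus_diag_uniq.
  transitivity ((g ^ 3 - 2 * h * (1 + g + h)) / (2 * (1 + 2 * g))); [field; lra|].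
  rewrite rel; field; lra. }
assert (el : lam2 N = (h + g ^ 2) * (h + 2 * g) ^ 2 / (h * (1 + 2 * g) ^ 3)).
{ unfold lam2; rewrite er, eN.
  apply Rminus_diag_uniq.
  transitivity ((g ^ 3 - 2 * h * (1 + g + h)) * (8 * h - 64 * g) /
    (16 * h * (1 + 2 * g) ^ 3)); [field; lra|].
  rewrite rel; field; lra. }
rewrite ek, el, J; rewrite eN; reflexivity.
Qed.

(** * Monotonicity and continuity of K *)

Lemma ellK_param_lt (a b : R) : a < b < 1 -> ellK_param a < ellK_param b.
Proof.
intros hab; assert (Pp := PI_RGT_0); apply RInt_lt; [lra| | |].
- intros t _; apply ellK_integrand_continuous; lra.
- intros t _; apply ellK_integrand_continuous; lra.
- intros t ht; unfold Rdiv; rewrite !Rmult_1_l.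
  assert (hs : 0 < sin t) by (apply sin_gt_0; lra).
  assert (hs2 : 0 < sin t ^ 2) by (now apply pow_lt).
  assert (hb := ellK_radicand_pos b t ltac:(lra)).
  assert (a * sin t ^ 2 < b * sin t ^ 2) by (apply Rmult_lt_compat_r; lra).
  apply Rinv_lt_contravar.
  + apply Rmult_lt_0_compat; apply sqrt_lt_R0; lra.
  + apply sqrt_lt_1_alt; lra.
Qed.

Lemma ellK_param_pos (m : R) : m < 1 -> 0 < ellK_param m.
Proof.
intros hm; apply RInt_gt_0; [generalize PI_RGT_0; lra| |].
- intros t _; assert (H := ellK_radicand_pos m t hm).
  apply Rdiv_lt_0_compat; [lra|now apply sqrt_lt_R0].
- intros t _; now apply ellK_integrand_continuous.
Qed.

(** The integrands differ by 1 / u - 1 / v = (v^2 - u^2) / (u v (u + v)), where both radicals are at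
    least sqrt (1 - c). *)
Lemma ellK_param_lipschitz (c a b : R) : 0 <= a < b -> b <= c < 1 ->
  ellK_param b - ellK_param a <= PI / 2 * / (sqrt (1 - c)) ^ 3 * (b - a).
Proof.
intros hab hc; assert (Pp := PI_RGT_0).
set (e := sqrt (1 - c)).
assert (he : 0 < e) by (apply sqrt_lt_R0; lra).
assert (he3 : 0 < / e ^ 3) by (now apply Rinv_0_lt_compat, pow_lt).
unfold ellK_param.
change (RInt (fun t => 1 / sqrt (1 - b * sin t ^ 2)) 0 (PI / 2) -
  RInt (fun t => 1 / sqrt (1 - a * sin t ^ 2)) 0 (PI / 2)) with
  (minus (RInt (fun t => 1 / sqrt (1 - b * sin t ^ 2)) 0 (PI / 2))
  (RInt (fun t => 1 / sqrt (1 - a * sin t ^ 2)) 0 (PI / 2))).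
rewrite <- (RInt_minus (V := R_CompleteNormedModule)) by (apply ellK_param_ex; lra).
apply Rle_trans with (RInt (V := R_CompleteNormedModule)
  (fun _ => / e ^ 3 * (b - a)) 0 (PI / 2)).
2: { rewrite RInt_const; unfold scal; simpl; unfold mult; simpl; lra. }
apply RInt_le; [lra| |apply ex_RInt_const|].
- apply (ex_RInt_minus (V := R_NormedModule)); apply ellK_param_ex; lra.
- intros t _; change (1 / sqrt (1 - b * sin t ^ 2) - 1 / sqrt (1 - a * sin t ^ 2) <= / e ^ 3 * (b - a)).
  assert (hs := sin2_le1 t); set (s := sin t ^ 2) in *.
  assert (e1 : e <= sqrt (1 - b * s)) by (apply sqrt_le_1_alt; nra).
  assert (e2 : sqrt (1 - b * s) <= sqrt (1 - a * s)) by (apply sqrt_le_1_alt; nra).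
  assert (q1 := sqrt_sqrt (1 - b * s) ltac:(nra)).
  assert (q2 := sqrt_sqrt (1 - a * s) ltac:(nra)).
  set (u := sqrt (1 - b * s)) in *; set (v := sqrt (1 - a * s)) in *.
  replace (1 / u - 1 / v) with ((v * v - u * u) * / (u * v * (u + v)))
    by (field; repeat split; nra).
  rewrite Rmult_comm; apply Rmult_le_compat.
  + apply Rlt_le, Rinv_0_lt_compat. assert (0 < u * v) by nra. nra.
  + nra.
  + apply Rinv_le_contravar; [now apply pow_lt|].
    assert (e * e <= u * v) by nra. nra.
  + rewrite q1, q2; nra.
Qed.

Lemma ellK_param_continuous (m : R) : 0 < m < 1 -> continuity_pt ellK_param m.
Proof.
(* With [c] halfway from [m] to 1, one Lipschitz constant serves all of [0, c]; the bounds on [d]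
   below keep x in that interval. *)
intros hm; set (c := (1 + m) / 2).
set (L := PI / 2 * / (sqrt (1 - c)) ^ 3).
assert (hL : 0 < L).
{ apply Rmult_lt_0_compat; [generalize PI_RGT_0; lra|].
  apply Rinv_0_lt_compat, pow_lt, sqrt_lt_R0; unfold c; lra. }
intros eps heps.
set (d := Rmin (eps / L) (Rmin m ((1 - m) / 2))).
assert (hd : 0 < d).
{ unfold d; repeat apply Rmin_glb_lt; try lra; now apply Rdiv_lt_0_compat. }
assert (d1 : d <= eps / L) by apply Rmin_l.
assert (d2 : d <= m) by (eapply Rle_trans; [apply Rmin_r|apply Rmin_l]).
assert (d3 : d <= (1 - m) / 2) by (eapply Rle_trans; [apply Rmin_r|apply Rmin_r]).
assert (d4 : d * L <= eps).
{ replace eps with (eps / L * L) by (field; lra). apply Rmult_le_compat_r; lra. }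
exists d; split; [easy|].
intros x [[_ hne] hx]; simpl in hx |- *; unfold R_dist in hx |- *; apply Rabs_def2 in hx.
assert (hc : c = (1 + m) / 2) by reflexivity.
destruct (Rtotal_order x m) as [hlt|[heq|hgt]].
- assert (H := ellK_param_lipschitz c x m ltac:(lra) ltac:(lra)).
  assert (H2 := ellK_param_lt x m ltac:(lra)).
  fold L in H.
  assert (L * (m - x) < L * d) by (apply Rmult_lt_compat_l; lra).
  apply Rabs_def1; lra.
- subst; rewrite Rminus_eq_0, Rabs_R0; easy.
- assert (H := ellK_param_lipschitz c m x ltac:(lra) ltac:(lra)).
  assert (H2 := ellK_param_lt m x ltac:(lra)).
  fold L in H.
  assert (L * (x - m) < L * d) by (apply Rmult_lt_compat_l; lra).
  apply Rabs_def1; lra.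
Qed.

(** * The quotient K'/K and its range *)

Definition period_ratio (m : R) : R := ellK_param (1 - m) / ellK_param m.

Lemma period_ratio_decr (a b : R) :
  0 < a -> a < b -> b < 1 -> period_ratio b < period_ratio a.
Proof.
intros h0 hab h1; unfold period_ratio.
assert (ellK_param a < ellK_param b) by (apply ellK_param_lt; lra).
assert (ellK_param (1 - b) < ellK_param (1 - a)) by (apply ellK_param_lt; lra).
assert (0 < ellK_param a) by (apply ellK_param_pos; lra).
assert (0 < ellK_param (1 - b)) by (apply ellK_param_pos; lra).
apply Rlt_div_l; [lra|].
replace (ellK_param (1 - a) / ellK_param a * ellK_param b) with
  (ellK_param (1 - a) * ellK_param b / ellK_param a) by (field; lra).
apply Rlt_div_r; [lra|]; nra.
Qed.

Lemma period_ratio_inj (a b : R) :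
  0 < a < 1 -> 0 < b < 1 -> period_ratio a = period_ratio b -> a = b.
Proof.
intros ha hb e; destruct (Rtotal_order a b) as [h|[h|h]]; [|easy|].
- assert (H := period_ratio_decr a b ltac:(lra) h ltac:(lra)); lra.
- assert (H := period_ratio_decr b a ltac:(lra) h ltac:(lra)); lra.
Qed.

Lemma period_ratio_compl (m : R) : 0 < m < 1 -> period_ratio (1 - m) = / period_ratio m.
Proof.
intros hm; unfold period_ratio; replace (1 - (1 - m)) with m by ring.
assert (0 < ellK_param m) by (apply ellK_param_pos; lra).
assert (0 < ellK_param (1 - m)) by (apply ellK_param_pos; lra).
field; lra.
Qed.

(* Combines the transformation at [N] with the one at the dual parameter [5 / N]. *)
Lemma period_ratio_quintic (N : R) :
  1 < N < 5 -> period_ratio (kap2 N) = 5 * period_ratio (lam2 N).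
Proof.
intros hN; assert (e1 := ellK_param_quintic N hN).
assert (e2 := ellK_param_quintic _ (dual_range N hN)).
rewrite lam2_dual, kap2_dual in e2 by lra.
assert (hk := kap2_bounds N hN); assert (hl := lam2_bounds N hN).
assert (0 < ellK_param (kap2 N)) by (apply ellK_param_pos; lra).
unfold period_ratio; rewrite e1, e2; field; lra.
Qed.

(** [lam2] runs continuously from 0 at N = 1 to 1 at N = 5, so every modulus is the first member of
    some pair. *)
Lemma lam2_surj (m : R) : 0 < m < 1 -> exists N, 1 < N < 5 /\ lam2 N = m.
Proof.
intros hm.
assert (r1 : mrho 1 = 2) by (unfold mrho; apply sqrt_lem_1; lra).
assert (r5 : mrho 5 = 10) by (unfold mrho; apply sqrt_lem_1; lra).
assert (l1 : lam2 1 = 0) by (unfold lam2; rewrite r1; field).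
assert (l5 : lam2 5 = 1) by (unfold lam2; rewrite r5; field).
destruct (IVT_interv (fun x => lam2 x - m) 1 5) as [N [hN e]]; [|lra|lra|lra|].
- intros x hx; apply continuity_pt_filterlim.
  apply (ex_derive_continuous (V := R_NormedModule) (fun x => lam2 x - m)).
  assert (H := mrho_radicand_pos x ltac:(lra)).
  unfold lam2, mrho; auto_derive.
  replace (_ + 5 * x) with (x ^ 3 - 2 * x ^ 2 + 5 * x) by ring.
  repeat split; trivial; apply Rgt_not_eq; nra.
- exists N; split; [|lra].
  destruct hN as [[h1|h1] [h5|h5]]; subst; lra.
Qed.

(** The quintic step, repeated from the self-complementary parameter 1 / 2, shows that K'/K is
    unbounded; it replaces an asymptotic estimate of K near 1. *)
Lemma period_ratio_pow5 (n : nat) : exists m, 0 < m < 1 /\ period_ratio m = 5 ^ n.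
Proof.
induction n as [|n [m [hm e]]].
- exists (1 / 2); split; [lra|]; unfold period_ratio.
  replace (1 - 1 / 2) with (1 / 2) by field; simpl.
  apply Rdiv_diag; apply Rgt_not_eq, ellK_param_pos; lra.
- destruct (lam2_surj m hm) as [N [hN e2]].
  exists (kap2 N); split; [now apply kap2_bounds|].
  rewrite period_ratio_quintic, e2, e by easy; reflexivity.
Qed.

Lemma period_ratio_surj (rho : R) : 0 < rho -> exists m, 0 < m < 1 /\ period_ratio m = rho.
Proof.
intros hr.
assert (unb : forall y, exists m, 0 < m < 1 /\ y < period_ratio m).
{ intros y; destruct (Pow_x_infinity 5 ltac:(rewrite Rabs_pos_eq; lra) (y + 1)) as [n hn].
  destruct (period_ratio_pow5 n) as [m [hm e]]; exists m; split; [easy|].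
  specialize (hn n (le_n n)); rewrite Rabs_pos_eq in hn by (apply pow_le; lra); lra. }
(* [b'] has ratio above 1 / rho, so its complement has ratio below rho. *)
destruct (unb rho) as [a [ha hra]]; destruct (unb (/ rho)) as [b' [hb hrb]].
assert (hrb' : period_ratio (1 - b') < rho).
{ rewrite period_ratio_compl by easy.
  rewrite <- (Rinv_inv rho); apply Rinv_lt_contravar; [|easy].
  assert (0 < / rho) by (now apply Rinv_0_lt_compat); nra. }
set (b := 1 - b') in *.
assert (hb1 : 0 < b < 1) by (unfold b; lra).
assert (hab : a < b).
{ destruct (Rtotal_order a b) as [h|[h|h]]; [easy|subst; lra|].
  assert (H := period_ratio_decr b a ltac:(lra) h ltac:(lra)); lra. }
destruct (IVT_interv (fun x => rho - period_ratio x) a b) as [m [hm e]]; [|lra|lra|lra|].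
- intros x hx; unfold period_ratio.
  apply continuity_pt_minus; [apply continuity_pt_const; now intros ? ?|].
  apply continuity_pt_div.
  + apply (continuity_pt_comp (fun x => 1 - x) ellK_param).
    * apply continuity_pt_minus; [apply continuity_pt_const; now intros ? ?|].
      apply continuity_pt_id.
    * apply ellK_param_continuous; lra.
  + apply ellK_param_continuous; lra.
  + apply Rgt_not_eq, ellK_param_pos; lra.
- exists m; split; lra.
Qed.

(** * Singular moduli *)

Lemma is_singular_modulusE (r k : R) :
  is_singular_modulus r k <-> 0 < k < 1 /\ period_ratio (k ^ 2) = sqrt r.
Proof.
unfold is_singular_modulus; split; intros [hk e]; split; trivial;
  revert e; unfold period_ratio, ellK, ellK_param;
  rewrite pow2_sqrt by nra; easy.
Qed.

(** [iota] needs uniqueness, which is the injectivity of K'/K. *)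
Lemma sing_mod_sqr_eq (r m : R) :
  0 < m < 1 -> period_ratio m = sqrt r -> sing_mod r = sqrt m.
Proof.
intros hm e.
assert (hs : 0 < sqrt m < 1).
{ split; [apply sqrt_lt_R0; lra|]; rewrite <- sqrt_1; apply sqrt_lt_1_alt; lra. }
assert (hq : sqrt m ^ 2 = m) by (apply pow2_sqrt; lra).
unfold sing_mod.
apply (iota_unique (V := R_CompleteNormedModule)).
- intros y hy; apply is_singular_modulusE in hy; destruct hy as [hy ey].
  assert (y ^ 2 = m).
  { apply period_ratio_inj; trivial; [nra|]; now rewrite ey. }
  rewrite <- H; symmetry; apply sqrt_pow2; lra.
- apply is_singular_modulusE; split; [easy|]; now rewrite hq.
Qed.

Lemma sing_mod_prod (r m : R) : 0 < m < 1 -> period_ratio m = sqrt r ->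
  0 < sing_mod r * sing_mod' r /\ (sing_mod r * sing_mod' r) ^ 2 = m * (1 - m).
Proof.
intros hm e; unfold sing_mod'; rewrite (sing_mod_sqr_eq r m hm e).
rewrite pow2_sqrt by lra; split.
- apply Rmult_lt_0_compat; apply sqrt_lt_R0; lra.
- rewrite Rpow_mult_distr, !pow2_sqrt by lra; reflexivity.
Qed.

(** K'/K decreases and takes reciprocal values at m and 1 - m, so it is below 1 to the right of 1 /
    2. *)
Lemma period_ratio_ge1 (m : R) : 0 < m < 1 -> 1 <= period_ratio m -> m <= 1 / 2.
Proof.
intros hm h1; destruct (Rle_lt_dec m (1 / 2)) as [|h]; [easy|].
assert (H := period_ratio_decr (1 - m) m ltac:(lra) ltac:(lra) ltac:(lra)).
rewrite period_ratio_compl in H by easy.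
assert (/ period_ratio m <= 1) by (rewrite <- Rinv_1; apply Rinv_le_contravar; lra).
lra.
Qed.

(** * The functions U* and U *)

Lemma pow_inj_pos (n : nat) (a b : R) :
  (0 < n)%nat -> 0 < a -> 0 < b -> a ^ n = b ^ n -> a = b.
Proof.
intros hn ha hb e.
assert (root : forall x, 0 < x -> Rpower (x ^ n) (/ INR n) = x).
{ intros x hx; rewrite <- Rpower_pow, Rpower_mult by easy.
  rewrite Rinv_r by (apply not_0_INR; lia); now apply Rpower_1. }
now rewrite <- (root a ha), <- (root b hb), e.
Qed.

(** In terms of N the radicand 1 + 18 Y^6 + Y^12 is the square of (10 N - N^2 - 5) / (5 - N), and X
    = U*(Y) satisfies X^2 Y^2 = 5 (N - 1) / (5 - N). *)
Lemma Ustar_pow6 (N Y : R) : 1 < N < 5 -> 0 < Y -> Y ^ 6 = N * (N - 1) / (5 - N) ->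
  Ustar Y ^ 6 = 125 * (N - 1) ^ 2 / (N * (5 - N) ^ 2).
Proof.
intros hN hY e.
assert (hs : sqrt (1 + 18 * Y ^ 6 + Y ^ 12) = (10 * N - N ^ 2 - 5) / (5 - N)).
{ apply sqrt_lem_1.
  - assert (0 < Y ^ 6) by (now apply pow_lt). assert (0 < Y ^ 12) by (now apply pow_lt). lra.
  - apply Rlt_le, Rdiv_lt_0_compat; nra.
  - replace (Y ^ 12) with (Y ^ 6 * Y ^ 6) by ring; rewrite e; field; lra. }
assert (hY2 : 0 < Y ^ 2) by (now apply pow_lt).
assert (hX : - (1 / (2 * Y ^ 2)) + Y ^ 4 / 2 + sqrt (1 + 18 * Y ^ 6 + Y ^ 12) / (2 * Y ^ 2) =
  5 * (N - 1) / ((5 - N) * Y ^ 2)).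
{ rewrite hs; transitivity ((Y ^ 6 - 1 + (10 * N - N ^ 2 - 5) / (5 - N)) / (2 * Y ^ 2));
    [field; lra|]; rewrite e; field; lra. }
unfold Ustar; rewrite hX.
set (q := 5 * (N - 1) / ((5 - N) * Y ^ 2)).
assert (hq : 0 < q) by (apply Rdiv_lt_0_compat; nra).
replace (sqrt q ^ 6) with ((sqrt q ^ 2) ^ 3) by ring.
rewrite pow2_sqrt by lra; unfold q.
transitivity (125 * (N - 1) ^ 3 / ((5 - N) ^ 3 * Y ^ 6)); [field; lra|].
rewrite e; field; lra.
Qed.

Lemma cos_Carg (z : C) : z <> RtoC 0 -> Cmod z * cos (Carg z) = Re z.
Proof.
intros hz; assert (hm : 0 < Cmod z) by (now apply Cmod_gt_0).
assert (hb : -1 <= Re z / Cmod z <= 1).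
{ assert (H := Rmax_Cmod z).
  assert (Rabs (Re z) <= Cmod z) by (eapply Rle_trans; [apply Rmax_l|exact H]).
  apply Rabs_le_between in H0.
  split; [apply Rle_div_r|apply Rle_div_l]; lra. }
assert (hc : cos (Carg z) = Re z / Cmod z).
{ unfold Carg; destruct (Rle_dec 0 (Im z)); [|rewrite cos_neg]; now apply cos_acos. }
rewrite hc; field; lra.
Qed.

Lemma Croot_polar (n : nat) (z : C) : (0 < n)%nat -> z <> RtoC 0 ->
  exists rho theta, Croot n z = (rho * cos theta, rho * sin theta) /\
    rho ^ n * cos (INR n * theta) = Re z.
Proof.
intros hn hz; exists (Rroot n (Cmod z)), (Carg z / INR n); split.
- unfold Croot; destruct (Ceq_dec z (RtoC 0)) as [e|_]; [easy|].
  apply injective_projections; simpl; ring.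
- rewrite Rroot_pow by (trivial; now apply Cmod_gt_0).
  replace (INR n * (Carg z / INR n)) with (Carg z)
    by (field; apply not_0_INR; lia).
  now apply cos_Carg.
Qed.

Lemma Re_Croot2_sqr (z : C) (u : R) : Croot 2 z = RtoC u -> 0 < u -> u ^ 2 = Re z.
Proof.
intros e hu.
assert (hz : z <> RtoC 0).
{ intros hz; unfold Croot in e; destruct (Ceq_dec z (RtoC 0)); [|easy].
  apply RtoC_inj in e; lra. }
destruct (Croot_polar 2 z ltac:(lia) hz) as [rho [th [e1 <-]]].
rewrite e in e1; injection e1 as e1 e2.
simpl INR; replace (1 + 1) with 2 by ring; rewrite cos_2a.
transitivity (u ^ 2 - 0 ^ 2); [ring|]; rewrite e2, e1; ring.
Qed.

(** Triple angle formula: for w = p + i q the left side is Re (w^3). *)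
Lemma Re_Croot3_cubic (z : C) : z <> RtoC 0 ->
  let p := Re (Croot 3 z) in let q := Im (Croot 3 z) in
  4 * p ^ 3 - 3 * p * (p ^ 2 + q ^ 2) = Re z.
Proof.
intros hz; destruct (Croot_polar 3 z ltac:(lia) hz) as [rho [th [-> <-]]]; simpl Re; simpl Im.
replace (INR 3) with 3 by (simpl; lra).
replace (3 * th) with (2 * th + th) by ring.
rewrite cos_plus, cos_2a, sin_2a; intros p q; unfold p, q; ring.
Qed.

(** The inner square root is purely imaginary, so the radicand of the cube root has real part -125 -
    9 x^6; knowing |h|^2 = 25 + 3 x^6 leaves a cubic in Re h alone. *)
Lemma h_cubic (x : R) : 0 < x ->
  4 * Re (h x) ^ 3 - 3 * Re (h x) * (25 + 3 * x ^ 6) = -125 - 9 * x ^ 6.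
Proof.
intros hx; destruct (h_facts x hx) as [<- _].
assert (h6 : 0 < x ^ 6) by (now apply pow_lt).
assert (hneg : 0 < 125 * x ^ 6 + 22 * x ^ 12 + x ^ 18).
{ assert (0 < x ^ 12) by (now apply pow_lt). assert (0 < x ^ 18) by (now apply pow_lt). lra. }
assert (er : Croot 2 (RtoC (-125 * x ^ 6 - 22 * x ^ 12 - x ^ 18)) =
  (0, sqrt (125 * x ^ 6 + 22 * x ^ 12 + x ^ 18))).
{ rewrite <- Croot2_neg by easy; do 2 f_equal; ring. }
unfold h; rewrite er, Re_Croot3_cubic.
- simpl; ring.
- intros e; apply (f_equal fst) in e; simpl in e; nra.
Qed.

(** Since |h|^2 = 25 + 3 X^6, the two terms with h in the denominator add up to conj(h) / (3 X^2),
    which the last term completes to 2 Re h / (3 X^2). *)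
Lemma U_sqr (X : R) : 0 < X -> U X ^ 2 = (2 * Re (h X) - 5) / (3 * X ^ 2).
Proof.
intros hX; destruct (U_complexE X hX) as [e hU]; unfold U_complex in e.
rewrite (Re_Croot2_sqr _ _ e hU).
destruct (h_facts X hX) as [hm hre].
destruct (h X) as [p q]; simpl Re in hm, hre; simpl Im in hm.
assert (hX2 : 0 < X ^ 2) by (now apply pow_lt).
assert (hX6 : 0 < X ^ 6) by (now apply pow_lt).
assert (e1 : forall c d s : R, d <> 0 -> s = 25 + 3 * X ^ 6 -> p ^ 2 + q ^ 2 = s ->
  Re (RtoC c / (RtoC d * (p, q)))%C = c * p / (d * s)).
{ intros c d s hd hs hpq; unfold Cdiv.
  unfold Cinv; simpl.
  replace ((d * p - 0 * q) * ((d * p - 0 * q) * 1) + (d * q + 0 * p) * ((d * q + 0 * p) * 1))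
    with (d ^ 2 * s) by (rewrite <- hpq; ring).
  field; lra. }
rewrite !re_plus, e1 with (s := 25 + 3 * X ^ 6) by (trivial; lra).
replace (RtoC (X ^ 4) / (p, q))%C with (RtoC (X ^ 4) / (RtoC 1 * (p, q)))%C
  by (f_equal; ring).
rewrite e1 with (s := 25 + 3 * X ^ 6) by (trivial; lra).
replace (Re ((p, q) / RtoC (3 * X ^ 2))%C) with (p / (3 * X ^ 2)).
- simpl Re; field; lra.
- unfold Cdiv, Cinv; simpl; field; lra.
Qed.

(** The equation for Y = U(X), cleared of denominators by sqrt 5 X^2 Y^3, is a cubic in Y^2, and
    [U_sqr] turns it into [h_cubic]. *)
Lemma U_equation (X : R) : 0 < X ->
  X ^ 2 * (U X ^ 2) ^ 3 + 5 * (U X ^ 2) ^ 2 - X ^ 4 * U X ^ 2 - X ^ 2 = 0.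
Proof.
intros hX; assert (e := h_cubic X hX); rewrite (U_sqr X hX).
set (p := Re (h X)) in *; clearbody p.
transitivity (8 * (4 * p ^ 3 - 3 * p * (25 + 3 * X ^ 6) - (-125 - 9 * X ^ 6)) / (4 * 27 * X ^ 4));
  [field; lra|].
rewrite e; field; lra.
Qed.

(** Eliminating the linear term between the cubics for W and Z leaves W - Z times a factor that is
    positive for positive W and Z. *)
Lemma U_unique (X Z : R) : 0 < X -> 0 < Z ->
  X ^ 2 * Z ^ 3 + 5 * Z ^ 2 - X ^ 4 * Z - X ^ 2 = 0 -> U X ^ 2 = Z.
Proof.
intros hX hZ e; assert (eU := U_equation X hX).
assert (hU : 0 < U X ^ 2) by (apply pow_lt, U_complexE, hX).
set (W := U X ^ 2) in *; clearbody W.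
assert (hX2 : 0 < X ^ 2) by (now apply pow_lt).
assert (H : (W - Z) * (X ^ 2 * (W * Z) * (W + Z) + 5 * (W * Z) + X ^ 2) = 0).
{ transitivity (Z * (X ^ 2 * W ^ 3 + 5 * W ^ 2 - X ^ 4 * W - X ^ 2) -
    W * (X ^ 2 * Z ^ 3 + 5 * Z ^ 2 - X ^ 4 * Z - X ^ 2)); [ring|].
  rewrite e, eU; ring. }
apply Rmult_integral in H; destruct H as [H|H]; [lra|exfalso].
assert (0 < W * Z) by (now apply Rmult_lt_0_compat).
assert (0 < X ^ 2 * (W * Z) * (W + Z)).
{ repeat apply Rmult_lt_0_compat; trivial; lra. }
lra.
Qed.

(** * The map Q *)

(** T(x) is [x * quartic x]; as quartic (5 / x) = 25 quartic x / x^4, the value 125 / T(5 / x) is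
    [x ^ 5 / quartic x]. *)
Definition quartic (x : R) : R := x ^ 4 + 5 * x ^ 3 + 15 * x ^ 2 + 25 * x + 25.

Lemma quartic_pos (x : R) : 0 < quartic x.
Proof.
unfold quartic.
replace (_ + 25) with ((x ^ 2 + 5 / 2 * x) ^ 2 + 35 / 4 * (x + 10 / 7) ^ 2 + 50 / 7) by field.
generalize (pow2_ge_0 (x ^ 2 + 5 / 2 * x)) (pow2_ge_0 (x + 10 / 7)); lra.
Qed.

(* With [v = exp (y / 5)], the parameter is [x = v - 1 / v - 1]. *)
Lemma Q_parametrization (t : R) : 0 < t ->
  exists x, 0 < x /\ x * quartic x = t /\ Q t = x ^ 5 / quartic x.
Proof.
intros ht; set (y := arcsinh ((11 + t) / 2)); set (v := exp (1 / 5 * y)).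
assert (hv : 0 < v) by apply exp_pos.
assert (ev : forall k, exp (INR k / 5 * y) = v ^ k).
{ intros k; unfold v; rewrite <- Rpower_pow by apply exp_pos.
  unfold Rpower; rewrite ln_exp; f_equal; field. }
assert (e5 : v ^ 5 - / v ^ 5 = 11 + t).
{ assert (H := sinh_arcsinh ((11 + t) / 2)); fold y in H; unfold sinh in H.
  rewrite exp_Ropp in H.
  replace (exp y) with (v ^ 5) in H by (rewrite <- ev; f_equal; simpl; field); lra. }
set (x := v - / v - 1).
assert (ex : x * quartic x = t).
{ transitivity (v ^ 5 - / v ^ 5 - 11); [unfold x, quartic; field; lra|lra]. }
assert (hq := quartic_pos x).
exists x; split; [|split; [exact ex|]].
- destruct (Rlt_le_dec 0 x) as [|h0]; [easy|nra].
- unfold Q; fold y; fold v.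
  assert (e2 := ev 2%nat); assert (e3 := ev 3%nat); assert (e4 := ev 4%nat);
  assert (e1 := ev 5%nat); assert (e6 := ev 6%nat); assert (e7 := ev 7%nat);
  assert (e8 := ev 8%nat); assert (e9 := ev 9%nat).
  replace (INR 2) with 2 in e2 by (simpl; lra).
  replace (INR 3) with 3 in e3 by (simpl; lra).
  replace (INR 4) with 4 in e4 by (simpl; lra).
  replace (INR 5 / 5 * y) with y in e1 by (simpl; field).
  replace (INR 6) with 6 in e6 by (simpl; lra).
  replace (INR 7) with 7 in e7 by (simpl; lra).
  replace (INR 8) with 8 in e8 by (simpl; lra).
  replace (INR 9) with 9 in e9 by (simpl; lra).
  rewrite e2, e3, e4, e1, e6, e7, e8, e9.
  replace (-1 - v + v ^ 2) with (v * x) by (unfold x; field; lra).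
  replace (v - v ^ 2 + _ - _ + _ + _ + _ + _ + _) with (v ^ 5 * quartic x)
    by (unfold x, quartic; field; lra).
  field; split; lra.
Qed.

(** * Linking consecutive pairs of moduli *)

(** On (1, 5) the quotient (a - 1)^2 / a increases and (5 - a)^2 decreases, so 125 (a - 1)^2 / (a (5
    - a)^2) increases. *)
Lemma tau_le (s t a b : R) : 1 < a < 5 -> 1 < b < 5 -> 0 < s -> s <= t ->
  125 * (a - 1) ^ 2 = s * (a * (5 - a) ^ 2) ->
  125 * (b - 1) ^ 2 = t * (b * (5 - b) ^ 2) -> a <= b.
Proof.
intros ha hb hs hst ea eb; destruct (Rle_lt_dec a b) as [|hab]; [easy|exfalso].
assert (h1 : (b - 1) ^ 2 * a < (a - 1) ^ 2 * b).
{ assert ((a - 1) ^ 2 * b - (b - 1) ^ 2 * a = (a - b) * (a * b - 1)) by ring.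
  assert (0 < (a - b) * (a * b - 1)) by (apply Rmult_lt_0_compat; nra). lra. }
assert (h2 : (5 - a) ^ 2 < (5 - b) ^ 2) by nra.
assert (h3 : s * (a * (5 - a) ^ 2) * (b * (5 - b) ^ 2) <=
  t * (b * (5 - b) ^ 2) * (a * (5 - a) ^ 2)).
{ assert (0 < b * (5 - b) ^ 2) by (apply Rmult_lt_0_compat; nra).
  assert (0 < a * (5 - a) ^ 2) by (apply Rmult_lt_0_compat; nra).
  assert (0 < (a * (5 - a) ^ 2) * (b * (5 - b) ^ 2)) by (now apply Rmult_lt_0_compat).
  nra. }
rewrite <- ea, <- eb in h3.
assert (0 < (5 - a) ^ 2) by nra.
assert (0 < (b - 1) ^ 2 * a) by (apply Rmult_lt_0_compat; nra).
assert ((b - 1) ^ 2 * a * (5 - a) ^ 2 < (a - 1) ^ 2 * b * (5 - b) ^ 2) by nra.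
lra.
Qed.

(* For [a = 16 / (k k')^2], the 24th power of a Weber function, [J] is the modular
   invariant j. *)
Lemma weber_j_inj (a b J : R) : 0 < a -> 0 < b -> 0 < J ->
  (a - 16) ^ 3 = a * J -> (b - 16) ^ 3 = b * J -> a = b.
Proof.
intros ha hb hJ ea eb.
assert (big : forall f, 0 < f -> (f - 16) ^ 3 = f * J -> 0 < f - 16).
{ intros f hf e; destruct (Rlt_le_dec 0 (f - 16)) as [|hle]; [easy|].
  assert (0 < (f - 16) ^ 3) by (rewrite e; now apply Rmult_lt_0_compat).
  assert (0 <= (f - 16) ^ 2) by nra. nra. }
assert (ha' := big a ha ea); assert (hb' := big b hb eb).
set (u := a - 16) in *; set (v := b - 16) in *.
assert (e : (u - v) * (u * v * (u + v) + 16 * (u ^ 2 + u * v + v ^ 2)) = 0).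
{ transitivity (u ^ 3 * b - v ^ 3 * a); [unfold u, v; ring|rewrite ea, eb; ring]. }
apply Rmult_integral in e; destruct e as [e|e]; [unfold u, v in e; lra|exfalso].
assert (0 < u * v) by (now apply Rmult_lt_0_compat).
assert (0 < u * v * (u + v)) by (apply Rmult_lt_0_compat; lra).
assert (0 < u ^ 2) by (now apply pow_lt). assert (0 < v ^ 2) by (now apply pow_lt). lra.
Qed.

Lemma quartic_frac_le (x y : R) : 0 < x -> x <= y ->
  x * quartic x <= y * quartic y /\ x ^ 5 / quartic x <= y ^ 5 / quartic y.
Proof.
intros hx hxy; assert (hq := quartic_pos).
assert (p2 : x ^ 2 <= y ^ 2) by (apply pow_incr; lra).
assert (p3 : x ^ 3 <= y ^ 3) by (apply pow_incr; lra).
assert (p4 : x ^ 4 <= y ^ 4) by (apply pow_incr; lra).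
assert (hle : quartic x <= quartic y) by (unfold quartic; lra).
assert (hqx := hq x); assert (hqy := hq y).
split; [apply Rmult_le_compat; lra|].
apply Rmult_le_reg_r with (quartic x * quartic y); [now apply Rmult_lt_0_compat|].
replace (x ^ 5 / quartic x * (quartic x * quartic y)) with (x ^ 5 * quartic y) by (field; lra).
replace (y ^ 5 / quartic y * (quartic x * quartic y)) with (y ^ 5 * quartic x) by (field; lra).
(* Cross-multiplied, the inequality is a positive combination of x^5 y^i <= y^5 x^i for i = 0, ...,
   4. *)
assert (0 < x * y) by nra.
assert (q1 : (x * y) ^ 1 * x ^ 4 <= (x * y) ^ 1 * y ^ 4)
  by (apply Rmult_le_compat_l; [apply pow_le|]; lra).
assert (q2 : (x * y) ^ 2 * x ^ 3 <= (x * y) ^ 2 * y ^ 3)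
  by (apply Rmult_le_compat_l; [apply pow_le|]; lra).
assert (q3 : (x * y) ^ 3 * x ^ 2 <= (x * y) ^ 3 * y ^ 2)
  by (apply Rmult_le_compat_l; [apply pow_le|]; lra).
assert (q4 : (x * y) ^ 4 * x <= (x * y) ^ 4 * y)
  by (apply Rmult_le_compat_l; [apply pow_le|]; lra).
assert (q5 : x ^ 5 <= y ^ 5) by (apply pow_incr; lra).
unfold quartic; lra.
Qed.

(* [a] and [b] below are 16 / (k k')^2 computed from the two pairs of moduli. *)
Lemma quintic_link_compl (N M x : R) : 1 < N < 5 -> 1 < M < 5 -> 0 < x ->
  125 * (N - 1) ^ 2 = x * quartic x * (N * (5 - N) ^ 2) ->
  125 * (M - 1) ^ 2 = x ^ 5 / quartic x * (M * (5 - M) ^ 2) ->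
  kap2 N * (1 - kap2 N) = lam2 M * (1 - lam2 M).
Proof.
intros hN hM hx eN eM; rewrite kap2_compl, lam2_compl by lra.
set (a := 4096 * N / ((N - 1) ^ 5 * (5 - N))).
set (b := 4096 * M ^ 5 / ((M - 1) * (5 - M) ^ 5)).
assert (0 < (N - 1) ^ 5) by (apply pow_lt; lra).
assert (0 < (5 - M) ^ 5) by (apply pow_lt; lra).
assert (0 < M ^ 5) by (apply pow_lt; lra).
assert (0 < x ^ 5) by (now apply pow_lt).
assert (hq := quartic_pos x).
assert (eab : a = b).
{ assert (hJ : 0 < x ^ 10 + 10 * x ^ 5 * quartic x + 5 * quartic x ^ 2).
  { assert (0 < x ^ 10) by (now apply pow_lt).
    assert (0 < quartic x ^ 2) by (now apply pow_lt).
    assert (0 < x ^ 5 * quartic x) by (now apply Rmult_lt_0_compat). lra. }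
  (* The common value of j: it is (t^2 + 250 t + 3125)^3 / t^5 in t = x quartic x, and (s^2 + 10 s +
     5)^3 / s in s = x^5 / quartic x. *)
  apply weber_j_inj with
    ((x ^ 10 + 10 * x ^ 5 * quartic x + 5 * quartic x ^ 2) ^ 3 / (x ^ 5 * quartic x ^ 5)).
  - apply Rdiv_lt_0_compat; [lra|apply Rmult_lt_0_compat; lra].
  - apply Rdiv_lt_0_compat; [lra|apply Rmult_lt_0_compat; lra].
  - apply Rdiv_lt_0_compat; [now apply pow_lt|].
    apply Rmult_lt_0_compat; [easy|now apply pow_lt].
  - set (t := x * quartic x) in *.
    assert (ht : t = 125 * (N - 1) ^ 2 / (N * (5 - N) ^ 2))
      by (rewrite eN; field; split; lra).
    transitivity (a * ((t ^ 2 + 250 * t + 3125) ^ 3 / t ^ 5)).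
    + rewrite ht; unfold a; field; repeat split; lra.
    + replace (x ^ 10 + 10 * x ^ 5 * quartic x + 5 * quartic x ^ 2) with
        (t ^ 2 + 250 * t + 3125) by (unfold t, quartic; ring).
      unfold t; field; lra.
  - set (s := x ^ 5 / quartic x) in *.
    assert (hs : s = 125 * (M - 1) ^ 2 / (M * (5 - M) ^ 2))
      by (rewrite eM; field; split; lra).
    transitivity (b * ((s ^ 2 + 10 * s + 5) ^ 3 / s)).
    + rewrite hs; unfold b; field; repeat split; lra.
    + unfold s; field; lra. }
replace ((N - 1) ^ 5 * (5 - N) / (256 * N)) with (16 / a)
  by (unfold a; field; repeat split; lra).
rewrite eab; unfold b; field; repeat split; lra.
Qed.

(** The factors carry the signs of 1 - 2 kap2 N and 1 - 2 lam2 M. Both N and M grow with x, so each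
    factor changes sign once, at the same x. *)
Lemma quintic_link_sign (N M x : R) : 1 < N < 5 -> 1 < M < 5 -> 0 < x ->
  125 * (N - 1) ^ 2 = x * quartic x * (N * (5 - N) ^ 2) ->
  125 * (M - 1) ^ 2 = x ^ 5 / quartic x * (M * (5 - M) ^ 2) ->
  0 <= (1 + 4 * N - N ^ 2) * (25 - 20 * M - M ^ 2).
Proof.
intros hN hM hx eN eM.
(* At [x = sqrt 5] both factors vanish; this is the case [r = 1]. *)
set (e := sqrt 5).
assert (he2 : e ^ 2 = 5) by (apply pow2_sqrt; lra).
assert (he : 2.2 < e < 2.25).
{ assert (0 <= e) by apply sqrt_pos; split; nra. }
assert (eq : quartic e = 125 + 50 * e).
{ unfold quartic; transitivity ((e ^ 2) ^ 2 + 5 * e * e ^ 2 + 15 * e ^ 2 + 25 * e + 25);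
    [ring|rewrite he2; ring]. }
(* 2 + e and 5 e - 10 are the positive zeros of the two factors; they are shown to be the N and M
   belonging to x = e. *)
assert (eN0 : 125 * (2 + e - 1) ^ 2 = e * quartic e * ((2 + e) * (5 - (2 + e)) ^ 2)).
{ rewrite eq; apply Rminus_diag_uniq.
  transitivity ((e ^ 2 - 5) * (-50 * e ^ 3 + 75 * e ^ 2 + 400 * e - 25)); [ring|].
  rewrite he2; ring. }
assert (eM0 : 125 * (5 * e - 10 - 1) ^ 2 =
  e ^ 5 / quartic e * ((5 * e - 10) * (5 - (5 * e - 10)) ^ 2)).
{ rewrite eq.
  replace (e ^ 5 / (125 + 50 * e)) with (e - 2).
  - apply Rminus_diag_uniq.
    transitivity ((e ^ 2 - 5) * (-125 * e ^ 2 + 1250 * e - 2125)); [ring|].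
    rewrite he2; ring.
  - apply Rmult_eq_reg_r with (125 + 50 * e); [|lra].
    apply Rminus_diag_uniq.
    transitivity ((e ^ 2 - 5) * (- e ^ 3 - 5 * e + 50)); [field; lra|].
    rewrite he2; ring. }
assert (p1 : 0 < x * quartic x) by (apply Rmult_lt_0_compat; [|apply quartic_pos]; lra).
assert (p2 : 0 < x ^ 5 / quartic x) by (apply Rdiv_lt_0_compat; [now apply pow_lt|apply quartic_pos]).
assert (p3 : 0 < e * quartic e) by (apply Rmult_lt_0_compat; [|apply quartic_pos]; lra).
assert (p4 : 0 < e ^ 5 / quartic e) by (apply Rdiv_lt_0_compat; [apply pow_lt; lra|apply quartic_pos]).
replace (1 + 4 * N - N ^ 2) with ((2 + e - N) * (N + e - 2)) by
  (transitivity (1 + 4 * N - N ^ 2 + (e ^ 2 - 5)); [ring|rewrite he2; ring]).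
replace (25 - 20 * M - M ^ 2) with ((5 * e - 10 - M) * (M + 5 * e + 10)) by
  (transitivity (25 - 20 * M - M ^ 2 + 25 * (e ^ 2 - 5)); [ring|rewrite he2; ring]).
assert (0 < (N + e - 2) * (M + 5 * e + 10)) by (apply Rmult_lt_0_compat; lra).
assert (0 <= (2 + e - N) * (5 * e - 10 - M)).
{ destruct (Rle_lt_dec x e) as [h|h].
  - destruct (quartic_frac_le x e hx h) as [h1 h2].
    assert (N <= 2 + e) by (eapply tau_le; [| |exact p1|exact h1|exact eN|exact eN0]; lra).
    assert (M <= 5 * e - 10) by (eapply tau_le; [| |exact p2|exact h2|exact eM|exact eM0]; lra).
    nra.
  - destruct (quartic_frac_le e x ltac:(lra) ltac:(lra)) as [h1 h2].
    assert (2 + e <= N) by (eapply tau_le; [| |exact p3|exact h1|exact eN0|exact eN]; lra).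
    assert (5 * e - 10 <= M) by (eapply tau_le; [| |exact p4|exact h2|exact eM0|exact eM]; lra).
    nra. }
nra.
Qed.

(** Equal products m (1 - m) leave [lam2 M] equal to [kap2 N] or to its complement; lying on the
    same side of 1 / 2, complements are both 1 / 2. *)
Lemma quintic_link (N M x : R) : 1 < N < 5 -> 1 < M < 5 -> 0 < x ->
  125 * (N - 1) ^ 2 = x * quartic x * (N * (5 - N) ^ 2) ->
  125 * (M - 1) ^ 2 = x ^ 5 / quartic x * (M * (5 - M) ^ 2) ->
  lam2 M = kap2 N.
Proof.
intros hN hM hx eN eM.
assert (e := quintic_link_compl N M x hN hM hx eN eM).
assert (hs := quintic_link_sign N M x hN hM hx eN eM).
assert (k1 : 1 - 2 * kap2 N = mrho N / (8 * N) * (1 + 4 * N - N ^ 2))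
  by (unfold kap2; field; lra).
assert (l1 : 1 - 2 * lam2 M = mrho M / (8 * M ^ 3) * (25 - 20 * M - M ^ 2))
  by (unfold lam2; field; lra).
assert (0 < mrho N / (8 * N)) by (apply Rdiv_lt_0_compat; [apply mrho_pos|]; lra).
assert (0 < mrho M / (8 * M ^ 3)).
{ apply Rdiv_lt_0_compat; [apply mrho_pos|]; [lra|].
  assert (0 < M ^ 3) by (apply pow_lt; lra); lra. }
assert (0 <= (1 - 2 * kap2 N) * (1 - 2 * lam2 M)).
{ rewrite k1, l1.
  replace (_ * _) with (mrho N / (8 * N) * (mrho M / (8 * M ^ 3)) *
    ((1 + 4 * N - N ^ 2) * (25 - 20 * M - M ^ 2))) by ring.
  apply Rmult_le_pos; [|easy]; apply Rlt_le; now apply Rmult_lt_0_compat. }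
assert (H2 : (kap2 N - lam2 M) * (1 - kap2 N - lam2 M) = 0) by lra.
apply Rmult_integral in H2; destruct H2 as [H2|H2]; [lra|].
assert ((1 - 2 * kap2 N) ^ 2 <= 0) by (replace (lam2 M) with (1 - kap2 N) in * by lra; lra).
assert (1 - 2 * kap2 N = 0) by nra.
lra.
Qed.

(** * One application of P, and its iterates *)

Lemma tau_surj (s : R) : 0 < s ->
  exists M, 1 < M < 5 /\ 125 * (M - 1) ^ 2 = s * (M * (5 - M) ^ 2).
Proof.
intros hs.
destruct (IVT_interv (fun M => 125 * (M - 1) ^ 2 - s * (M * (5 - M) ^ 2)) 1 5)
  as [M [hM e]]; [|lra|lra|lra|].
- intros x _; apply continuity_pt_filterlim.
  apply (ex_derive_continuous (V := R_NormedModule)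
    (fun M => 125 * (M - 1) ^ 2 - s * (M * (5 - M) ^ 2))).
  auto_derive; trivial.
- exists M; split; [|lra].
  destruct hM as [[h1|h1] [h5|h5]]; subst; lra.
Qed.

(** P follows N -> t -> x -> s -> M and reproduces between [P Y] and M the relation between Y and N,
    so the step can be iterated. *)
Lemma P_step (N Y : R) : 1 < N < 5 -> 0 < Y -> Y ^ 6 = N * (N - 1) / (5 - N) ->
  exists M, 1 < M < 5 /\ lam2 M = kap2 N /\ 0 < P Y /\ P Y ^ 6 = M * (M - 1) / (5 - M).
Proof.
intros hN hY e; unfold P; rewrite (Ustar_pow6 N Y hN hY e).
set (t := 125 * (N - 1) ^ 2 / (N * (5 - N) ^ 2)).
assert (ht : 0 < t).
{ apply Rdiv_lt_0_compat; [nra|apply Rmult_lt_0_compat; nra]. }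
destruct (Q_parametrization t ht) as [x [hx [ex ->]]].
assert (hs : 0 < x ^ 5 / quartic x)
  by (apply Rdiv_lt_0_compat; [now apply pow_lt|apply quartic_pos]).
destruct (tau_surj _ hs) as [M [hM eM]].
exists M; split; [easy|].
split.
{ apply (quintic_link N M x); trivial; rewrite ex; unfold t; field; split; lra. }
set (s := x ^ 5 / quartic x) in *.
assert (hX : 0 < Rroot 6 s) by apply exp_pos.
assert (hX6 := Rroot_pow 6 s ltac:(lia) hs).
set (X := Rroot 6 s) in *.
split; [apply U_complexE, hX|].
set (b := M * (M - 1) / (5 - M)).
assert (hb : 0 < b) by (apply Rdiv_lt_0_compat; nra).
set (Z := Rroot 3 b).
assert (hZ : 0 < Z) by apply exp_pos.
assert (hZ3 : Z ^ 3 = b) by (apply Rroot_pow; [lia|easy]).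
assert (hX2 : 0 < X ^ 2) by (now apply pow_lt).
(* [Z] is the candidate for U(X)^2. This relation, obtained from its cube, makes the cubic of
   [U_unique] a rational identity in M. *)
assert (c : X ^ 2 * Z = 5 * (M - 1) / (5 - M)).
{ apply (pow_inj_pos 3); [lia| | |].
  - now apply Rmult_lt_0_compat.
  - apply Rdiv_lt_0_compat; lra.
  - transitivity (X ^ 6 * Z ^ 3); [ring|]; rewrite hX6, hZ3.
    transitivity (s * (M * (5 - M) ^ 2) * (M - 1) / (5 - M) ^ 3);
      [unfold b; field; lra|].
    rewrite <- eM; field; lra. }
replace (U X ^ 6) with ((U X ^ 2) ^ 3) by ring.
rewrite (U_unique X Z hX hZ); [exact hZ3|].
apply (Rmult_eq_reg_r Z); [|lra].
transitivity (X ^ 2 * Z * Z ^ 3 + 5 * Z ^ 3 - (X ^ 2 * Z) ^ 2 - X ^ 2 * Z); [ring|].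
rewrite c, hZ3; unfold b; field; lra.
Qed.

Lemma ratio_pow24 (N Y : R) : 1 < N < 5 -> Y ^ 6 = N * (N - 1) / (5 - N) ->
  lam2 N * (1 - lam2 N) * Y ^ 24 = kap2 N * (1 - kap2 N).
Proof.
intros hN e; rewrite kap2_compl, lam2_compl by lra.
replace (Y ^ 24) with ((Y ^ 6) ^ 4) by ring; rewrite e; field; lra.
Qed.

Lemma prod_1_to_S (n : nat) (f : nat -> R) :
  prod_1_to (S n) f = prod_1_to n f * f (S n).
Proof.
unfold prod_1_to; rewrite seq_S, map_app, fold_right_app; simpl.
generalize (map f (seq 1 n)); intros l; rewrite Rmult_1_r.
induction l as [|a l IH]; simpl; [ring|rewrite IH; ring].
Qed.

(** The n-th iterate belongs to the pair ending at 25^n r0, and each pair starts where the previous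
    one ends, so the product telescopes. [Y0] belongs to the pair ending at r0, hence the product
    starts at j = 1. *)
Lemma P_iter_invariant (r0 N0 Y0 : R) (n : nat) :
  0 < r0 -> 1 < N0 < 5 -> 0 < Y0 -> Y0 ^ 6 = N0 * (N0 - 1) / (5 - N0) ->
  period_ratio (kap2 N0) = sqrt r0 ->
  exists N, 1 < N < 5 /\ 0 < Nat.iter n P Y0 /\
    Nat.iter n P Y0 ^ 6 = N * (N - 1) / (5 - N) /\
    period_ratio (kap2 N) = sqrt (25 ^ n * r0) /\
    kap2 N0 * (1 - kap2 N0) * prod_1_to n (fun j => Nat.iter j P Y0 ^ 24) =
    kap2 N * (1 - kap2 N).
Proof.
intros hr hN0 hY0 e0 er; induction n as [|n [N [hN [hY [e [en ep]]]]]].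
- exists N0; simpl Nat.iter; repeat split; try easy.
  + rewrite er; f_equal; simpl; ring.
  + unfold prod_1_to; simpl; ring.
- destruct (P_step N _ hN hY e) as [M [hM [el [hP eP]]]].
  exists M; split; [easy|]; split; [exact hP|]; split; [exact eP|]; split.
  + rewrite period_ratio_quintic, el, en by easy.
    replace (25 ^ S n * r0) with (5 ^ 2 * (25 ^ n * r0)) by (simpl; ring).
    rewrite (sqrt_mult_alt (5 ^ 2)), sqrt_pow2 by lra; reflexivity.
  + rewrite prod_1_to_S, <- Rmult_assoc, ep, <- el.
    apply ratio_pow24; [easy|exact eP].
Qed.

Theorem mainTheorem1 (r0 : R) (n : nat) (hr0 : 0 < r0) (hn : (1 <= n)%nat)
    (hrn : 1 <= 25 ^ n * r0) :
  sing_mod (25 ^ n * r0) =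
  sqrt (1 / 2 - 1 / 2 *
    sqrt (1 - 4 * (sing_mod r0 * sing_mod' r0) ^ 2 *
      prod_1_to n (fun j =>
        Nat.iter j P
          (Rroot 12 ((sing_mod r0 * sing_mod' r0) /
                     (sing_mod (r0 / 25) * sing_mod' (r0 / 25)))) ^ 24))).
Proof.
(* The first pair starts at r0 / 25, with squared modulus [m], and ends at r0. *)
destruct (period_ratio_surj (sqrt (r0 / 25))) as [m [hm em]].
{ apply sqrt_lt_R0; lra. }
destruct (lam2_surj m hm) as [N0 [hN0 eN0]].
assert (hk := kap2_bounds N0 hN0).
assert (er : period_ratio (kap2 N0) = sqrt r0).
{ rewrite period_ratio_quintic, eN0, em by easy.
  rewrite <- (sqrt_pow2 5) at 1 by lra; rewrite <- sqrt_mult_alt by lra.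
  f_equal; field. }
destruct (sing_mod_prod r0 (kap2 N0) hk er) as [ha ea].
destruct (sing_mod_prod (r0 / 25) m hm em) as [hb eb].
set (a := sing_mod r0 * sing_mod' r0) in *.
set (b := sing_mod (r0 / 25) * sing_mod' (r0 / 25)) in *.
assert (hab : 0 < a / b) by (now apply Rdiv_lt_0_compat).
set (Y0 := Rroot 12 (a / b)).
assert (hY0 : 0 < Y0) by apply exp_pos.
assert (e12 : Y0 ^ 12 = a / b) by (apply Rroot_pow; [lia|easy]).
assert (e6 : Y0 ^ 6 = N0 * (N0 - 1) / (5 - N0)).
{ apply (pow_inj_pos 4); [lia|now apply pow_lt|apply Rdiv_lt_0_compat; nra|].
  transitivity ((Y0 ^ 12) ^ 2); [ring|]; rewrite e12.
  transitivity (a ^ 2 / b ^ 2); [field; lra|].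
  rewrite ea, eb, <- eN0, kap2_compl, lam2_compl by lra; field; lra. }
destruct (P_iter_invariant r0 N0 Y0 n hr0 hN0 hY0 e6 er) as [N [hN [_ [_ [en ep]]]]].
assert (hkN := kap2_bounds N hN).
rewrite (sing_mod_sqr_eq _ (kap2 N) hkN en), ea, (Rmult_assoc 4), ep.
(* Here [hrn] enters: the inner root is 1 - 2 k^2 rather than its negative exactly when k^2 <= 1 /
   2. *)
assert (hle : kap2 N <= 1 / 2).
{ apply period_ratio_ge1; [easy|]; rewrite en, <- sqrt_1; now apply sqrt_le_1_alt. }
replace (1 - 4 * (kap2 N * (1 - kap2 N))) with ((1 - 2 * kap2 N) ^ 2) by ring.
rewrite sqrt_pow2 by lra; f_equal; field.
Qed.
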